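(* Let $\{G_n\}_{n\ge0}$ be a Gibonacci sequence and let $\{G'_n\}_{n\ge0}$ be the associated modified Gibonacci sequence. For all integers $m,n\geq 3$, both of the following hold: $$G_nf_{m-2}+G_0f_{n-2}f_{m-3}=G'_mf_{n-2}+G_1f_{n-3}f_{m-2},$$ and $$(G_1G_{n-1}+G_0G_{n-2})G_{m-2}+G_0G_{n-2}G_{m-3}=(G_1G'_{m-1}+G_0G'_{m-2})G_{n-2}+G_1G_{n-3}G_{m-2}.$$
   Context: A Gibonacci sequence is a sequence satisfying $G_n=G_{n-1}+G_{n-2}$ for $n\ge2$, with initial values $G_0,G_1$ chosen freely (here arbitrary integers). The associated modified Gibonacci sequence is defined by $G'_0=G_1$, $G'_1=G_0$ and $G'_n=G'_{n-1}+G'_{n-2}$ for $n\ge 2$. The numbers $f_n$ are the shifted Fibonacci numbers $f_n=F_{n+1}$, where $F_0=0$, $F_1=1$, $F_n=F_{n-1}+F_{n-2}$ (so $f_0=f_1=1$, $f_2=2$). *)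

(* Defs.v *)
From mathcomp Require Import all_boot all_order all_algebra.
Set Implicit Arguments.
Unset Strict Implicit.
Unset Printing Implicit Defensive.
Import GRing.Theory.
Local Open Scope ring_scope.

Definition is_gibonacci (G : nat -> int) : Prop :=
  forall n : nat, (2 <= n)%N -> G n = G (n - 1)%N + G (n - 2)%N.

Fixpoint gibonacci (a b : int) (n : nat) : int :=
  match n with
  | 0%N => a
  | n1.+1 => match n1 with
             | 0%N => b
             | n2.+1 => gibonacci a b n1 + gibonacci a b n2
             end
  end.

(* Exchanges the two initial values of G, keeping the same recurrence. *)
Definition modified_gibonacci (G : nat -> int) : nat -> int :=
  gibonacci (G 1%N) (G 0%N).

Definition fibonacci : nat -> int := gibonacci 0 1.

(* Index shift f_n = F_(n+1): the values start 1, 1, 2, 3. *)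
Definition shifted_fibonacci (n : nat) : int := fibonacci n.+1.

(* Main.v *)
Require Import Defs.
From mathcomp Require Import all_boot all_order all_algebra.
From mathcomp Require Import ring.
Set Implicit Arguments.
Unset Strict Implicit.
Unset Printing Implicit Defensive.
Import GRing.Theory.
Local Open Scope ring_scope.

(** A Gibonacci sequence is the combination of two shifts of the Fibonacci
    sequence with its initial values as coefficients
    ([gibonacci_fibonacciE]); exchanging the initial values exchanges the
    coefficients. Substituting this for [G n] and [G' m] makes both sides of
    the first identity equal to
    [G 0 * f (n - 2) * f (m - 1) + G 1 * f (n - 1) * f (m - 2)].

    In the second identity, merge [G (m - 2) + G (m - 3)] into [G (m - 1)] on
    the left, and expand [G (n - 1)] as [G (n - 2) + G (n - 3)] to cancel
    the terms in [G (n - 3)]. What is left is [G (n - 2)] times the case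
    [k = m - 2] of [gibonacci_exchange]. *)

Lemma is_gibonacciSS (G : nat -> int) (hG : is_gibonacci G) (n : nat) :
  G n.+2 = G n.+1 + G n.
Proof. by rewrite hG // !subSS !subn0. Qed.

Lemma modified_is_gibonacci (G : nat -> int) :
  is_gibonacci (modified_gibonacci G).
Proof. by case=> [|[|n]] // _; rewrite !subSS !subn0. Qed.

Lemma fibonacciSS (n : nat) : fibonacci n.+2 = fibonacci n.+1 + fibonacci n.
Proof. by []. Qed.

Lemma gibonacci_fibonacciE (G : nat -> int) (hG : is_gibonacci G) (n : nat) :
  G n.+1 = G 0%N * fibonacci n + G 1%N * fibonacci n.+1.
Proof.
(* The recurrence has order two, so the induction carries two ranks. *)
suff: G n.+1 = G 0%N * fibonacci n + G 1%N * fibonacci n.+1 /\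
      G n.+2 = G 0%N * fibonacci n.+1 + G 1%N * fibonacci n.+2 by case.
elim: n => [|n [IH1 IH2]].
  rewrite is_gibonacciSS // fibonacciSS.
  have -> : fibonacci 0 = 0 by [].
  have -> : fibonacci 1 = 1 by [].
  by split; ring.
split=> //.
by rewrite (is_gibonacciSS hG n.+1) IH1 IH2 !fibonacciSS; ring.
Qed.

Lemma modified_gibonacci_fibonacciE (G : nat -> int) (n : nat) :
  modified_gibonacci G n.+1 = G 1%N * fibonacci n + G 0%N * fibonacci n.+1.
Proof. exact: gibonacci_fibonacciE (modified_is_gibonacci G) n. Qed.

(** The right side is the left side with the initial values exchanged, and the
    left side is symmetric in them: for [k = j + 1] it equals
    [G 0 * G 1 * (F j + F (j + 2)) + (G 0 ^+ 2 + G 1 ^+ 2) * F (j + 1)], where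
    [F] is [fibonacci]. The case [k = 0] is apart because the expansion in
    Fibonacci numbers starts at rank 1. *)
Lemma gibonacci_exchange (G : nat -> int) (hG : is_gibonacci G) (k : nat) :
  G 1%N * G k + G 0%N * G k.+1 =
  G 1%N * modified_gibonacci G k.+1 + G 0%N * modified_gibonacci G k.
Proof.
case: k => [|k]; first by rewrite /modified_gibonacci /=; ring.
rewrite !modified_gibonacci_fibonacciE (gibonacci_fibonacciE hG k).
rewrite (gibonacci_fibonacciE hG k.+1).
by rewrite fibonacciSS; ring.
Qed.

Theorem mainTheorem9 (G : nat -> int) (hG : is_gibonacci G)
    (m n : nat) (hm : (3 <= m)%N) (hn : (3 <= n)%N) :
  let G' := modified_gibonacci G in
  let f := shifted_fibonacci in
  (G n * f (m - 2)%N + G 0%N * f (n - 2)%N * f (m - 3)%N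
   = G' m * f (n - 2)%N + G 1%N * f (n - 3)%N * f (m - 2)%N)
  /\
  ((G 1%N * G (n - 1)%N + G 0%N * G (n - 2)%N) * G (m - 2)%N
     + G 0%N * G (n - 2)%N * G (m - 3)%N
   = (G 1%N * G' (m - 1)%N + G 0%N * G' (m - 2)%N) * G (n - 2)%N
     + G 1%N * G (n - 3)%N * G (m - 2)%N).
Proof.
case: m hm => [|[|[|m]]] // _; case: n hn => [|[|[|n]]] // _ G' f.
rewrite !subSS !subn0; split.
  rewrite /f /shifted_fibonacci /G' modified_gibonacci_fibonacciE.
  by rewrite (gibonacci_fibonacciE hG n.+2) !fibonacciSS; ring.
rewrite -(gibonacci_exchange hG) (is_gibonacciSS hG m) (is_gibonacciSS hG n).
ring.
Qed.
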